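(* Let $\alpha\in(0,1)$ and $1\le p,q\le\infty$. Then $$\|f\|_{\mathrm{wav},\alpha,p,q}\le C_p\,\|f\|^{(b)}_{B^\alpha_{p,q}}\qquad\text{for all }f\in B^\alpha_{p,q}([0,1]),$$ where $C_p=\max\{1,2^{1/p}(1-1/b)b^\alpha\}$. In particular, $B^\alpha_{p,q}([0,1])\hookrightarrow\mathcal{H}_{\mathrm{wav},\alpha,p,q}$ continuously.
   Context: Convention $1/\infty=0$. Besov space on $[0,1]$: for $f\in L_p([0,1])$ and $0<\delta\le1$ let $\omega_p(f,\delta)=\sup_{0<h\le\delta}\big(\int_0^{1-h}|f(x+h)-f(x)|^pdx\big)^{1/p}$ (for $p=\infty$: $\sup_{h\le\delta}\operatorname{ess\,sup}_{0\le x\le1-h}|f(x+h)-f(x)|$). $B^\alpha_{p,q}([0,1])$ is the space of locally integrable $f$ with $\|f\|_{L_p}+\big(\int_0^1(t^{-\alpha}\omega_p(f,t))^q\frac{dt}{t}\big)^{1/q}<\infty$ (ess sup over $t\in(0,1]$ of $t^{-\alpha}\omega_p(f,t)$ if $q=\infty$). For an integer $b\ge2$, the equivalent norm is $\|f\|^{(b)}_{B^\alpha_{p,q}}=\|f\|_{L_p}+\big(\sum_{j=0}^\infty b^{j\alpha q}\omega_p(f,b^{-j})^q\big)^{1/q}$ (with $\sup_j b^{j\alpha}\omega_p(f,b^{-j})$ if $q=\infty$). Haar wavelet space (same base $b$): $\Delta_{-1}=\{0\}$, $\Delta_j=\{0,\dots,b^j-1\}$, $\nabla_0=\{0\}$,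 $\nabla_j=\{0,\dots,b-1\}$ ($j\ge1$); $\psi^0_{0,0}=1_{[0,1)}$ and for $j\ge1$, $i\in\nabla_j$, $k\in\Delta_{j-1}$: $\psi^j_{i,k}(x)=b^{j/2-1}(b\,1_{[b^{-j}(bk+i),b^{-j}(bk+i+1))}(x)-1_{[b^{1-j}k,b^{1-j}(k+1))}(x))$. For $f\in L_1([0,1])$, $\|f\|^q_{\mathrm{wav},\alpha,p,q}=\sum_{j=0}^\infty b^{q(\alpha-1/p+1/2)j}\big(\sum_{k\in\Delta_{j-1}}\sum_{i\in\nabla_j}|\langle f,\psi^j_{i,k}\rangle|^p\big)^{q/p}$ with $\langle f,g\rangle=\int_0^1fg$ (maximum if $p=\infty$, supremum over $j$ if $q=\infty$). $\mathcal{H}_{\mathrm{wav},\alpha,p,q}$ is the space of $f\in L_1([0,1])$ with finite norm; for $q=\infty$ it is additionally required that the wavelet series $\sum_{j,k,i}\langle f,\psi^j_{i,k}\rangle\psi^j_{i,k}$ converge pointwise and equal $f$ a.e. *)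

(* Defs.v *)
From HB Require Import structures.
From mathcomp Require Import all_boot all_order all_algebra.
From mathcomp Require Import all_classical all_reals all_analysis.
Set Implicit Arguments. Unset Strict Implicit. Unset Printing Implicit Defensive.
Import Order.TTheory GRing.Theory Num.Theory.
Import numFieldNormedType.Exports.
Local Open Scope classical_set_scope.
Local Open Scope ring_scope.

Section Besov.
Variable R : realType.
Local Notation mu := (@lebesgue_measure R).

(* 1/p with the convention 1/oo = 0 (p ranges over [1, +oo] in \bar R) *)
Definition inv_exp (p : \bar R) : R :=
  match p with r%:E => r^-1 | _ => 0 end.

Definition LpD (D : set R) (p : \bar R) (g : R -> R) : \bar R :=
  Lnorm mu p (fun x => (\1_D x * g x)%:E).

Definition omega (p : \bar R) (f : R -> R) (delta : R) : \bar R :=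
  ereal_sup [set LpD `[0, 1 - h] p (fun x => f (x + h) - f x) | h in `]0, delta]].

Definition lq_seq (q : \bar R) (a : nat -> \bar R) : \bar R :=
  match q with
  | r%:E => poweR (\sum_(0 <= j <oo) poweR (a j) r)%E r^-1
  | +oo%E => ereal_sup (range a)
  | -oo%E => 0%E
  end.

Definition lp_fin (p : \bar R) (m n : nat) (c : nat -> nat -> \bar R) : \bar R :=
  match p with
  | r%:E => poweR (\sum_(k < m) \sum_(i < n) poweR (c k i) r)%E r^-1
  | +oo%E => \big[maxe/0%E]_(k < m) \big[maxe/0%E]_(i < n) c k i
  | -oo%E => 0%E
  end.

Definition besov_norm (b : nat) (alpha : R) (p q : \bar R) (f : R -> R) : \bar R :=
  (LpD `[0%R, 1%R] p f +
   lq_seq q (fun j => ((b%:R `^ alpha) ^+ j)%:E * omega p f ((b%:R ^+ j)^-1)))%E.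

(* index sets: #Delta_{j-1} and #nabla_j *)
Definition nDelta (b j : nat) : nat := if j is j'.+1 then (b ^ j')%N else 1%N.
Definition nNabla (b j : nat) : nat := if j is 0 then 1%N else b.

Definition haar (b j k i : nat) (x : R) : R :=
  if j is 0 then \1_(`[0, 1[) x
  else b%:R `^ (j%:R / 2 - 1) *
       (b%:R * \1_(`[(b%:R ^+ j)^-1 * (b * k + i)%:R,
                     (b%:R ^+ j)^-1 * (b * k + i + 1)%:R[) x
        - \1_(`[(b%:R ^+ j.-1)^-1 * k%:R, (b%:R ^+ j.-1)^-1 * k.+1%:R[) x).

Definition haar_coef (b : nat) (f : R -> R) (j k i : nat) : \bar R :=
  (\int[mu]_(x in `[0%R, 1%R]) (f x * haar b j k i x)%:E)%E.

Definition wav_norm (b : nat) (alpha : R) (p q : \bar R) (f : R -> R) : \bar R :=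
  lq_seq q (fun j =>
    ((b%:R `^ (alpha - inv_exp p + 2^-1)) ^+ j)%:E *
    lp_fin p (nDelta b j) (nNabla b j) (fun k i => `|haar_coef b f j k i|%E))%E.

Definition haar_partial (b : nat) (f : R -> R) (J : nat) (x : R) : R :=
  \sum_(j < J) \sum_(k < nDelta b j) \sum_(i < nNabla b j)
     fine (haar_coef b f j k i) * haar b j k i x.

Definition in_Hwav (b : nat) (alpha : R) (p q : \bar R) (f : R -> R) : Prop :=
  mu.-integrable `[0, 1] (EFin \o f) /\
  (wav_norm b alpha p q f < +oo)%E /\
  (q = +oo%E ->
     {ae mu, forall x, `[0, 1]%classic x ->
        haar_partial b f J x @[J --> \oo] --> f x}).

Definition besov_seminorm_cont (alpha : R) (p q : \bar R) (f : R -> R) : \bar R :=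
  match q with
  | r%:E => poweR (\int[mu]_(t in `]0%R, 1%R])
               (poweR ((t `^ (- alpha))%:E * omega p f t) r * (t^-1)%:E))%E r^-1
  | +oo%E => Lnorm mu +oo%E
               (fun t => ((\1_(`]0%R, 1%R]) t)%:E * ((t `^ (- alpha))%:E * omega p f t))%E)
  | -oo%E => 0%E
  end.

Definition besov_norm_cont (alpha : R) (p q : \bar R) (f : R -> R) : \bar R :=
  (LpD `[0%R, 1%R] p f + besov_seminorm_cont alpha p q f)%E.

(* membership in B^alpha_{p,q}([0,1]): f integrable on [0,1] (= locally integrable
   on the compact [0,1]) with finite Besov norm *)
Definition in_Besov (alpha : R) (p q : \bar R) (f : R -> R) : Prop :=
  mu.-integrable `[0, 1] (EFin \o f) /\ (besov_norm_cont alpha p q f < +oo)%E.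

End Besov.

(* Main.v *)
Require Import Defs.
From HB Require Import structures.
From mathcomp Require Import all_boot all_order all_algebra.
From mathcomp Require Import all_classical all_reals all_analysis.
From mathcomp Require Import measurable_realfun ess_sup_inf ring lra.
Set Implicit Arguments. Unset Strict Implicit. Unset Printing Implicit Defensive.
Import Order.TTheory GRing.Theory Num.Theory.
Import numFieldNormedType.Exports.
Local Open Scope classical_set_scope.
Local Open Scope ring_scope.

(** On the [b]-adic mesh of width [d = b^-(j+1)], the Haar coefficient at [(k, i)]
    is, up to the factor [b^((j+1)/2 - 1)], the sum over the siblings [i' <> i]
    of the differences between the integrals of [f] over the cells [b k + i]
    and [b k + i'].  Such a difference is an integral of [f(x + d s) - f x] with
    [s = i' - i], so Jensen's inequality, applied to the cell and to the [b - 1]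
    siblings, bounds the [l_p] norm of level [j+1] by [omega_p(f, (b-1) d)]; each
    shift [s] is used for two ordered pairs, whence the factor [2^(1/p)].

    Keeping the argument [(b-1) d = (1 - 1/b) b^-j], rather than [b^-j], makes the
    continuous seminorm dominate the resulting sequence directly: the intervals
    from [(1 - 1/b) b^-j] to [b^-j] are pairwise disjoint and [omega_p(f, .)] is monotone.

    The partial sums of the wavelet series telescope to averages of [f] over
    [b]-adic cells, which converge almost everywhere by Lebesgue differentiation. *)

(** * Translation invariance of Lebesgue measure and of the integral *)

Section translation.
Context {R : realType}.
Local Notation mu := (@lebesgue_measure R).

Definition translate (h : R) : measurableTypeR R -> measurableTypeR R :=
  fun x => x + h.

Lemma measurable_translate (h : R) : measurable_fun [set: measurableTypeR R] (translate h).
Proof. exact: measurable_funD. Qed.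

Lemma preimage_translate_itv (h a b : R) (s t : bool) :
  translate h @^-1` [set` Interval (BSide s a) (BSide t b)] =
  [set` Interval (BSide s (a - h)) (BSide t (b - h))].
Proof.
apply/seteqP; split => x /=; rewrite !in_itv/= /translate;
  by case: s; case: t; rewrite /= ?lerBlDr ?ltrBlDr ?lerBrDr ?ltrBrDr.
Qed.

(** A measure that gives every interval []a, b]] its length is Lebesgue measure, and translation
    preserves lengths. *)
Lemma lebesgue_measure_translate (h : R) (A : set R) : measurable A ->
  pushforward mu (translate h) A = mu A.
Proof.
have mt := measurable_translate h.
pose mt_pack : {mfun _ >-> _} := HB.pack (translate h) (isMeasurableFun.Build _ _ _ _ _ mt).
move=> mA; apply/esym.
apply: (@lebesgue_measure_unique _ (pushforward mu mt_pack)) => //=.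
move=> _ [[a b]] _ <-.
rewrite /pushforward /= preimage_translate_itv !lebesgue_measure_itv/= !lte_fin.
by rewrite ltrD2r; case: ifPn => // _; rewrite -!EFinD; congr EFin; lra.
Qed.

Lemma integral_translate (h : R) (D : set R) (f : R -> R) : measurable D ->
  mu.-integrable [set: R] (EFin \o f) ->
  (\int[mu]_(x in translate h @^-1` D) (f (x + h))%:E =
   \int[mu]_(x in D) (f x)%:E)%E.
Proof.
move=> mD fi.
have mt := measurable_translate h.
have mf : measurable_fun [set: R] (EFin \o f) by case/integrableP: fi.
have e (E : set R) (g : R -> \bar R) : measurable E ->
    (\int[pushforward mu (translate h)]_(x in E) g x = \int[mu]_(x in E) g x)%E.
  move=> mE; apply: eq_measure_integral => A mA _.
  exact: lebesgue_measure_translate.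
have mpD : measurable (translate h @^-1` D).
  by rewrite -[X in measurable X]setTI; exact: mt.
rewrite -(e D)//; apply/esym; apply: (@integral_pushforward _ _ _ _ _ _ mt mu D _ mf) => //.
apply: (@integrableS _ _ _ _ setT) => //.
(* The signed change of variables asks for integrability of the translate; it comes from the
   nonnegative change of variables applied to [|f|]. *)
apply/integrableP; split; first exact: measurableT_comp.
rewrite -(@preimage_setT _ _ (translate h)).
have := @ge0_integral_pushforward _ _ _ _ _ _ mt mu setT
  (fun x => `|(f x)%:E|%E) measurableT.
move=> <-//; last exact: measurableT_comp.
by rewrite e//; case/integrableP: fi.
Qed.

Lemma integrable_translate (h : R) (f : R -> R) :
  mu.-integrable [set: R] (EFin \o f) ->
  mu.-integrable [set: R] (EFin \o (fun x => f (x + h))).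
Proof.
move=> fi.
have mf : measurable_fun [set: R] (EFin \o f) by case/integrableP: fi.
have mt := measurable_translate h.
apply/integrableP; split.
  exact: (@measurableT_comp _ _ _ _ _ _ (EFin \o f)).
have := integral_translate h measurableT (integrable_norm fi).
rewrite preimage_setT /= => ->.
by case/integrableP: fi.
Qed.

End translation.

(** * Convexity inequalities for powers *)

Section power_inequalities.
Context {R : realType}.
Implicit Types p q m n : R.

(** Convexity: the graph of [x ^ p] lies above its tangent at [m]. For [1 < p] this is Young's
    inequality for [x] and [m ^ (p - 1)] with exponents [p] and [p / (p - 1)]. *)
Lemma powR_tangent p m (x : R) : 1 <= p -> 0 <= m -> 0 <= x ->
  p * m `^ (p - 1) * x <= x `^ p + (p - 1) * m `^ p.
Proof.
rewrite le_eqVlt => /predU1P[<-|p1] m0 x0.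
  by rewrite subrr powRr0 !mul1r mul0r addr0 powRr1.
have p0 : 0 < p by rewrite (lt_trans _ p1).
have p10 : 0 < p - 1 by rewrite subr_gt0.
have pq : p^-1 + (p / (p - 1))^-1 = 1.
  by field; rewrite !gt_eqF.
have := @conjugate_powR _ x (m `^ (p - 1)) p (p / (p - 1)) x0 (powR_ge0 _ _)
  p0 (divr_gt0 p0 p10) pq.
rewrite -powRrM [_ * (p / _)]mulrC divfK ?gt_eqF// => H.
rewrite mulrAC -mulrA -(ler_pdivlMl _ _ p0).
apply: le_trans H _.
by rewrite le_eqVlt; apply/orP; left; apply/eqP; field; rewrite !gt_eqF.
Qed.

(** Jensen's inequality for a finite sum: the tangent inequality at the mean [m = S / n] is summed
    over the terms. *)
Lemma powR_sum_le (I : finType) (P : pred I) (a : I -> R) p n :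
  1 <= p -> 0 < n -> #|P|%:R <= n -> (forall i, P i -> 0 <= a i) ->
  (\sum_(i | P i) a i) `^ p <= n `^ (p - 1) * \sum_(i | P i) a i `^ p.
Proof.
move=> p1 n0 Pn a0; have p0 : 0 < p by rewrite (lt_le_trans _ p1).
set S := \sum_(i | P i) a i.
have S0 : 0 <= S by apply: sumr_ge0.
pose m := S / n; have m0 : 0 <= m by rewrite divr_ge0// ltW.
have Sm : S = n * m by rewrite mulrC divfK// gt_eqF.
rewrite {1}Sm powRM// ?(ltW n0)//.
rewrite -(mulr_powRB1 (ltW n0) p0) -mulrA mulrCA ler_pM2l ?powR_gt0//.
have : \sum_(i | P i) (p * m `^ (p - 1) * a i) <=
       \sum_(i | P i) (a i `^ p + (p - 1) * m `^ p).
  by apply: ler_sum => i Pi; exact: powR_tangent (a0 _ Pi).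
rewrite -mulr_sumr big_split/= sumr_const -/S {1}Sm -mulr_natr.
rewrite (_ : p * _ * (n * m) = p * n * m `^ p); last first.
  by rewrite -(mulr_powRB1 m0 p0); ring.
have : (p - 1) * m `^ p * #|P|%:R <= (p - 1) * m `^ p * n.
  by rewrite ler_wpM2l// mulr_ge0 ?powR_ge0// subr_ge0.
lra.
Qed.

(** With [z ^ q] written as [z * z ^ (q - 1)], it suffices that [x ^ (q - 1)] and [y ^ (q - 1)] are
    at most [(x + y) ^ (q - 1)]. *)
Lemma powR_superadditive q (x y : R) : 1 <= q -> 0 <= x -> 0 <= y ->
  x `^ q + y `^ q <= (x + y) `^ q.
Proof.
move=> q1 x0 y0; have q0 : 0 < q by rewrite (lt_le_trans _ q1).
rewrite -(mulr_powRB1 x0 q0) -(mulr_powRB1 y0 q0) -(mulr_powRB1 (addr_ge0 x0 y0) q0).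
rewrite mulrDl lerD// ler_wpM2l// ge0_ler_powR ?nnegrE ?subr_ge0 ?addr_ge0//.
  by rewrite lerDl.
by rewrite lerDr.
Qed.

(** Superadditivity applied to [x] and [y ^ (1/q)]. It serves to detach level zero of the wavelet
    norm from the later levels. *)
Lemma poweR_add_le q (x y : \bar R) : 1 <= q -> (0 <= x)%E -> (0 <= y)%E ->
  (poweR (poweR x q + y) q^-1 <= x + poweR y q^-1)%E.
Proof.
move=> q1; have q0 : 0 < q by rewrite (lt_le_trans _ q1).
have qi0 : q^-1 != 0 by rewrite invr_eq0 gt_eqF.
case: x => [x| |]//; last by rewrite addye ?leey// -ltNye (lt_le_trans _ (poweR_ge0 _ _)).
case: y => [y| |]//; last by rewrite [(+oo `^ q^-1)%E]poweRyr// addey// leey.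
move=> x0 y0; rewrite lee_fin in x0; rewrite lee_fin in y0.
rewrite (poweR_EFin x) -EFinD !poweR_EFin -EFinD lee_fin.
have {1}-> : y = (y `^ q^-1) `^ q by rewrite -powRrM mulVf ?gt_eqF// powRr1.
rewrite -[leRHS](@powRr1 _ (x + _)) ?addr_ge0 ?powR_ge0//.
rewrite -(mulfV (lt0r_neq0 q0)) powRrM ge0_ler_powR ?nnegrE ?addr_ge0 ?powR_ge0//.
  by rewrite invr_ge0 ltW.
by apply: powR_superadditive => //; rewrite powR_ge0.
Qed.

(** Jensen's inequality for an integral: the tangent inequality at the mean [m = S / c] is
    integrated over [D]. The right-hand side may be infinite, hence the extended reals. *)
Lemma powR_Rintegral_le d (T : measurableType d) (mu : {measure set T -> \bar R})
    (D : set T) (g : T -> R) p (c : R) : measurable D -> 0 < c -> mu D = c%:E ->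
  1 <= p -> mu.-integrable D (EFin \o g) -> (forall x : T, D x -> 0 <= g x) ->
  (((\int[mu]_(x in D) g x) `^ p)%:E <=
   (c `^ (p - 1))%:E * \int[mu]_(x in D) (g x `^ p)%:E)%E.
Proof.
move=> mD c0 muD p1 gi g0; have p0 : 0 < p by rewrite (lt_le_trans _ p1).
set S := (\int[mu]_(x in D) g x)%R.
have S0 : 0 <= S by apply: Rintegral_ge0.
have SE : (\int[mu]_(x in D) (g x)%:E)%E = S%:E.
  by rewrite /S /Rintegral fineK//; exact: integrable_fin_num.
pose m := S / c; have m0 : 0 <= m by rewrite divr_ge0// ltW.
have Sm : S = c * m by rewrite mulrC divfK// gt_eqF.
have mg : measurable_fun D g by apply/measurable_EFinP; case/integrableP: gi.
have mgp : measurable_fun D (fun x => g x `^ p).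
  exact: (measurableT_comp (measurable_powR _)).
rewrite [in leLHS]Sm powRM// ?(ltW c0)//.
rewrite -(mulr_powRB1 (ltW c0) p0) [c * _]mulrC -mulrA EFinM.
apply: lee_wpmul2l; first by rewrite lee_fin powR_ge0.
have : (\int[mu]_(x in D) ((p * m `^ (p - 1))%:E * (g x)%:E) <=
        \int[mu]_(x in D) ((g x `^ p)%:E + ((p - 1) * m `^ p)%:E))%E.
  have pm0 : 0 <= p * m `^ (p - 1) by rewrite mulr_ge0 ?powR_ge0// ltW.
  apply: ge0_le_integral => //.
  - by move=> x Dx; rewrite -EFinM lee_fin mulr_ge0 ?g0.
  - apply/measurable_EFinP; apply: measurable_funM => //.
  - by apply/measurable_EFinP; apply: measurable_funD.
  - by move=> x Dx; rewrite -EFinM -EFinD lee_fin powR_tangent ?g0.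
have c'0 : 0 <= (p - 1) * m `^ p by rewrite mulr_ge0 ?powR_ge0// subr_ge0.
rewrite integralZl//= SE ge0_integralD//=; last 2 first.
- by move=> x Dx; rewrite lee_fin powR_ge0.
- exact/measurable_EFinP.
rewrite integral_cst// muD -!EFinM -leeBlDr//.
rewrite Sm -EFinB.
rewrite (_ : p * _ * (c * m) - _ = c * m `^ p)//.
by rewrite -(mulr_powRB1 m0 p0); ring.
Qed.

End power_inequalities.

(** * Integrals over the cells of a uniform mesh *)

Section cells.
Context {R : realType}.
Local Notation mu := (@lebesgue_measure R).
Implicit Types (d : R) (n m s : nat) (f : R -> R).

Definition cell d n : set R := `[d * n%:R, d * n.+1%:R[%classic.

Definition cell_int f d n : R := \int[mu]_(x in cell d n) f x.

Lemma measurable_cell d n : measurable (cell d n).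
Proof. exact: measurable_itv. Qed.

#[local] Hint Extern 0 (@measurable _ _ (cell _ _)) =>
  solve [exact: measurable_cell] : core.

Lemma lebesgue_measure_cell d n : 0 < d -> mu (cell d n) = d%:E.
Proof.
move=> d0; rewrite lebesgue_measure_itv/= lte_fin ltr_pM2l// ltr_nat ltnSn.
by rewrite -EFinB -mulrBr -natrB// subSnn mulr1.
Qed.

(** [Lnorm] at [+oo] is an essential supremum under a test that the whole space has positive
    measure; this settles the test. *)
Lemma lebesgue_measureT_gt0 : (0 < mu [set: R])%E.
Proof.
apply: (@lt_le_trans _ _ (mu (cell 1 0))).
  by rewrite lebesgue_measure_cell.
by apply: le_measure; rewrite ?inE.
Qed.

Lemma preimage_translate_cell d n s :
  translate (d * s%:R) @^-1` cell d (n + s) = cell d n.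
Proof.
rewrite /cell preimage_translate_itv -addSn !natrD !mulrDr !addrK.
by [].
Qed.

Lemma integral_itv_cells (h : R -> \bar R) d n m : 0 <= d ->
  measurable_fun [set: R] h ->
  (\int[mu]_(x in `[(d * n%:R)%R, (d * (n + m)%:R)%R[) h x =
   \sum_(i < m) \int[mu]_(x in cell d (n + i)) h x)%E.
Proof.
move=> d0 mh; elim: m => [|m IH].
  by rewrite big_ord0 addn0 set_itvco0 integral_set0.
rewrite big_ord_recr/= -IH -integral_setU//=.
- rewrite /cell addnS -itv_bndbnd_setU//.
    by rewrite bnd_simp ler_wpM2l// ler_nat leq_addr.
  by rewrite bnd_simp ler_wpM2l// ler_nat leqnSn.
- exact: measurable_funTS.
- apply/disj_setPS => x [] /=; rewrite !in_itv/= => /andP[_ xm] /andP[mx _].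
  by move: mx; rewrite bnd_simp leNgt xm.
Qed.

Section Lp_cells.
Variable g : R -> R.
Hypothesis gi : mu.-integrable [set: R] (EFin \o g).

Let integrableT D : measurable D -> mu.-integrable D (EFin \o g).
Proof. by move=> mD; exact: (@integrableS _ _ _ _ setT). Qed.

(** Jensen on each cell, of measure [d], costs [d ^ (r - 1)]; the cell integrals of [|g| ^ r] then
    add up to an integral over a part of [[0, y]]. *)
Lemma sum_cell_powR_le_LpD d m (y r w : R) : 0 < d -> 1 <= r -> 0 <= w ->
  d * m%:R <= y -> (LpD `[0%R, y] r%:E g <= w%:E)%E ->
  \sum_(n < m) (\int[mu]_(x in cell d n) `|g x|) `^ r <= d `^ (r - 1) * w `^ r.
Proof.
move=> d0 r1 w0 dmy gw; have r0 : 0 < r by rewrite (lt_le_trans _ r1).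
have mg : measurable_fun [set: R] g.
  by apply/measurable_EFinP; case/integrableP: gi.
have mgr : measurable_fun [set: R] (fun x => (`|g x| `^ r)%:E).
  apply/measurable_EFinP; apply: (measurableT_comp (measurable_powR _)).
  exact: measurableT_comp.
rewrite -lee_fin -sumEFin.
have H : (\sum_(n < m) ((\int[mu]_(x in cell d n) `|g x|)%R `^ r)%:E <=
  \sum_(n < m) ((d `^ (r - 1))%:E * \int[mu]_(x in cell d n) (`|g x| `^ r)%:E))%E.
  apply: lee_sum => n _.
  apply: (@powR_Rintegral_le _ _ _ mu (cell d n) (fun x => `|g x|)) => //.
    exact: lebesgue_measure_cell.
  exact/integrable_norm/integrableT.
apply: (le_trans H).
rewrite -ge0_sume_distrr; last by move=> *; apply: integral_ge0 => x _; rewrite lee_fin powR_ge0.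
rewrite EFinM lee_wpmul2l ?lee_fin ?powR_ge0//.
under eq_bigr => n _ do rewrite -{1}[n : nat]add0n.
rewrite -integral_itv_cells// ?(ltW d0)// add0n mulr0.
apply: (@le_trans _ _ (\int[mu]_(x in `[0%R, y]) (`|g x| `^ r)%:E)%E).
  apply: ge0_subset_integral => //.
  - exact: measurable_funTS.
  - move=> x /=; rewrite !in_itv/= => /andP[-> /= xm].
    exact: le_trans (ltW xm) _.
have : (poweR (LpD `[0%R, y] r%:E g) r <= poweR w%:E r)%E.
  apply: gt0_ler_poweR; rewrite ?in_itv/= ?leey ?andbT ?lee_fin ?(ltW r0)//.
  exact: Lnorm_ge0.
rewrite /LpD poweR_Lnorm ?gt_eqF//; apply: le_trans.
rewrite le_eqVlt; apply/orP; left; apply/eqP.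
(* [LpD] multiplies by an indicator instead of restricting the domain; the two agree because
   [0 ^ r = 0] for [r] nonzero. *)
rewrite [LHS]integral_mkcond; apply: eq_integral => x _.
rewrite patchE indicE; case: ifPn => [xD|xD] /=; first by rewrite mul1r.
by rewrite mul0r normr0 powR0 ?gt_eqF.
Qed.

(** Endpoint analogue of the previous bound: [|g| <= w] almost everywhere on a cell of measure
    [d]. *)
Lemma cell_le_LpDy d n (y w : R) : 0 < d -> 0 <= w -> d * n.+1%:R <= y ->
  (LpD `[0%R, y] +oo g <= w%:E)%E ->
  \int[mu]_(x in cell d n) `|g x| <= d * w.
Proof.
move=> d0 w0 dny.
rewrite /LpD unlock ifT => [/ess_supP gw|]; last exact: lebesgue_measureT_gt0.
have ni : mu.-integrable (cell d n) (EFin \o (fun x => `|g x|)).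
  exact/integrable_norm/integrableT.
have mg : measurable_fun (cell d n) (EFin \o (fun x => `|g x|)) by case/integrableP: ni.
rewrite -lee_fin /Rintegral fineK; last exact: integrable_fin_num.
have -> : (d * w)%:E = (\int[mu]_(x in cell d n) w%:E)%E.
  by rewrite integral_cst//= lebesgue_measure_cell// -EFinM mulrC.
apply: ae_ge0_le_integral => //.
apply: filterS gw => x /= gw; rewrite /cell/= in_itv/= => /andP[x1 x2].
move: gw; rewrite indicE mem_set ?mul1r//= in_itv/= (le_trans _ x1) ?mulr_ge0 ?(ltW d0)//=.
exact: le_trans (ltW x2) _.
Qed.

End Lp_cells.

Section integrable_function.
Variable f : R -> R.
Hypothesis fi : mu.-integrable [set: R] (EFin \o f).

Let integrableT D : measurable D -> mu.-integrable D (EFin \o f).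
Proof. by move=> mD; exact: (@integrableS _ _ _ _ setT). Qed.

Let mf : measurable_fun [set: R] f.
Proof. by apply/measurable_EFinP; case/integrableP: fi. Qed.

Lemma cell_intE d n :
  (\int[mu]_(x in cell d n) (f x)%:E = (cell_int f d n)%:E)%E.
Proof.
rewrite /cell_int /Rintegral fineK//; apply: integrable_fin_num => //.
exact: integrableT.
Qed.

Lemma cell_int_split (b : nat) d k : 0 <= d ->
  cell_int f (b%:R * d) k = \sum_(i < b) cell_int f d (b * k + i).
Proof.
move=> d0; apply: EFin_inj; rewrite -cell_intE -sumEFin.
under eq_bigr do rewrite -cell_intE.
rewrite -integral_itv_cells//; last exact/measurable_EFinP.
rewrite /cell (_ : b%:R * d * k%:R = d * (b * k)%:R) ?natrM; last by ring.
by rewrite (_ : b%:R * d * k.+1%:R = d * (b * k + b)%:R)// natrD natrM -natr1; ring.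
Qed.

Lemma integrable_cell_diff d s D : measurable D ->
  mu.-integrable D (EFin \o (fun x => f (x + d * s%:R) - f x)).
Proof.
move=> mD; apply: (@integrableS _ _ _ _ setT) => //.
have := integrableB _ (integrable_translate (d * s%:R) fi) fi.
by move=> /(_ measurableT).
Qed.

(** Translation by [d * s] carries cell [n] onto cell [n + s], so both integrals can be taken over
    cell [n]. *)
Lemma cell_int_dist d n s :
  `|cell_int f d (n + s) - cell_int f d n| <=
  \int[mu]_(x in cell d n) `|f (x + d * s%:R) - f x|.
Proof.
have mc := measurable_cell d n.
have -> : cell_int f d (n + s) = \int[mu]_(x in cell d n) f (x + d * s%:R).
  rewrite /cell_int /Rintegral -(integral_translate (d * s%:R))//.
  by rewrite preimage_translate_cell.
rewrite -RintegralB//; last 2 first.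
- by apply: (@integrableS _ _ _ _ setT) => //; exact: integrable_translate.
- exact: integrableT.
by apply: le_normr_Rintegral => //; exact: integrable_cell_diff.
Qed.

(** The condition on [m + s] places the first [m] cells inside [[0, 1 - d * s]], the domain on which
    the modulus measures the shift [d * s]. *)
Lemma sum_cell_int_dist_powR d s m (r w : R) : 0 < d -> 1 <= r -> 0 <= w ->
  d * (m + s)%:R <= 1 ->
  (LpD `[0%R, (1 - d * s%:R)%R] r%:E (fun x => f (x + d * s%:R) - f x)%R <= w%:E)%E ->
  \sum_(n < m) `|cell_int f d (n + s) - cell_int f d n| `^ r <= d `^ (r - 1) * w `^ r.
Proof.
move=> d0 r1 w0 dms gw; have r0 : 0 < r by rewrite (lt_le_trans _ r1).
have gi := @integrable_cell_diff d s _ measurableT.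
have dm : d * m%:R <= 1 - d * s%:R by rewrite lerBrDr -mulrDr -natrD.
apply: le_trans (sum_cell_powR_le_LpD gi d0 r1 w0 dm gw).
apply: ler_sum => n _; rewrite ge0_ler_powR ?nnegrE ?(ltW r0)//.
  exact: Rintegral_ge0.
exact: cell_int_dist.
Qed.

Lemma cell_int_dist_LpDy d s n (w : R) : 0 < d -> 0 <= w ->
  d * (n.+1 + s)%:R <= 1 ->
  (LpD `[0%R, (1 - d * s%:R)%R] +oo (fun x => f (x + d * s%:R) - f x)%R <= w%:E)%E ->
  `|cell_int f d (n + s) - cell_int f d n| <= d * w.
Proof.
move=> d0 w0 dns gw; apply: (le_trans (cell_int_dist _ _ _)).
apply: cell_le_LpDy gw => //; first exact: integrable_cell_diff.
by rewrite lerBrDr -mulrDr -natrD.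
Qed.

End integrable_function.
End cells.

(** * Haar coefficients in terms of cell integrals *)

Section haar_coefficients.
Context {R : realType}.
Local Notation mu := (@lebesgue_measure R).
Variable f : R -> R.
Hypothesis fi : mu.-integrable [set: R] (EFin \o f).
Variable b : nat.
Hypothesis b1 : (1 < b)%N.

Definition adic_mesh (j : nat) : R := (b%:R ^+ j)^-1.
Local Notation mesh := adic_mesh.

Lemma base_gt0 : 0 < b%:R :> R.
Proof. by rewrite ltr0n ltnW. Qed.

Lemma mesh_gt0 j : 0 < mesh j.
Proof. by rewrite invr_gt0 exprn_gt0// base_gt0. Qed.

Lemma mesh0 : mesh 0 = 1.
Proof. by rewrite /adic_mesh expr0 invr1. Qed.

Lemma meshS j : mesh j = b%:R * mesh j.+1.
Proof. by rewrite /adic_mesh exprS invfM mulVKf// gt_eqF// base_gt0. Qed.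

Lemma mesh_mul_le1 j n : (n <= b ^ j)%N -> mesh j * n%:R <= 1.
Proof.
move=> nb; rewrite mulrC ler_pdivrMr ?exprn_gt0 ?base_gt0//.
by rewrite mul1r -natrX ler_nat.
Qed.

Lemma cell_sub01 j n : (n < b ^ j)%N -> cell (mesh j) n `<=` `[0, 1].
Proof.
move=> nb x; rewrite /cell/= !in_itv/= => /andP[x1 x2].
rewrite (le_trans _ x1) ?mulr_ge0 ?(ltW (mesh_gt0 _))//=.
by rewrite (le_trans (ltW x2))// mesh_mul_le1.
Qed.

Let patch_integral (A : set R) : measurable A -> A `<=` `[0, 1] ->
  (\int[mu]_(x in `[0%R, 1%R]) (f x * \1_A x)%:E = \int[mu]_(x in A) (f x)%:E)%E.
Proof.
move=> mA A01; rewrite -[in RHS](setIidr A01) [RHS]integral_mkcondr.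
apply: eq_integral => x _; rewrite patchE indicE; case: ifPn => xA.
  by rewrite mulr1.
by rewrite mulr0.
Qed.

Let patch_integrable (A : set R) : measurable A ->
  mu.-integrable `[0, 1] (fun x => (f x * \1_A x)%:E).
Proof.
move=> mA; apply: (@integrableS _ _ _ _ setT) => //.
have fA : mu.-integrable A (EFin \o f) by exact: (@integrableS _ _ _ _ setT).
have := (@integrable_mkcond _ _ _ mu A (EFin \o f) mA).1 fA.
apply: eq_integrable => // x _; rewrite patchE indicE; case: ifPn => xA.
  by rewrite mulr1.
by rewrite mulr0.
Qed.

Lemma haar_coef0 k i : haar_coef b f 0 k i = (cell_int f 1 0)%:E.
Proof.
rewrite /haar_coef /haar -cell_intE// patch_integral//=.
  by rewrite /cell mulr0 mulr1.
by move=> x /=; rewrite !in_itv/= => /andP[-> /ltW].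
Qed.

Lemma haar_coefS j k i : (k < b ^ j)%N -> (i < b)%N ->
  haar_coef b f j.+1 k i = (b%:R `^ (j.+1%:R / 2 - 1) *
   (b%:R * cell_int f (mesh j.+1) (b * k + i) - cell_int f (mesh j) k))%:E.
Proof.
move=> kb ib; rewrite /haar_coef /haar /=; set c := b%:R `^ _.
rewrite -/(mesh j) -/(mesh j.+1).
have -> : `[mesh j.+1 * (b * k + i)%:R, mesh j.+1 * (b * k + i + 1)%:R[%classic =
  cell (mesh j.+1) (b * k + i) by rewrite addn1.
rewrite -/(cell (mesh j) k).
set A := cell _ (b * k + i); set B := cell _ k.
have mA : measurable A by exact: measurable_cell.
have mB : measurable B by exact: measurable_cell.
transitivity (\int[mu]_(x in `[0%R, 1%R])
  ((c * b%:R)%:E * (f x * \1_A x)%:E + (- c)%:E * (f x * \1_B x)%:E))%E.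
  apply: eq_integral => x _; rewrite -!EFinM -EFinD; congr EFin; ring.
rewrite integralD//=; last 2 first.
- exact: integrableZl (patch_integrable mA).
- exact: integrableZl (patch_integrable mB).
rewrite !integralZl//=; last 2 first.
- exact: patch_integrable.
- exact: patch_integrable.
rewrite !patch_integral//; last 2 first.
- exact: cell_sub01.
- apply: cell_sub01; rewrite expnS.
  by rewrite (@leq_trans (b * k.+1))// ?leq_mul2l ?kb ?orbT// mulnS addnC ltn_add2r.
rewrite !cell_intE// -!EFinM -EFinD; congr EFin; ring.
Qed.

End haar_coefficients.

(** * Sums over pairs of indices in the same block *)

Section block_sums.
Context {R : realType}.

(** With [n = b * k + i], the left side keeps those [n] for which [n + s] stays in the block of [n].
    Such [n] satisfy [n + s < b * K], and the other terms on the right are nonnegative. *)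
Lemma sum_blocks_shift_le (b K s : nat) (G : nat -> R) :
  (forall n, 0 <= G n) ->
  \sum_(k < K) \sum_(i < b | (i + s < b)%N) G (b * k + i)%N <=
  \sum_(n < b * K - s) G n.
Proof.
move=> G0.
pose H n := if (n %% b + s < b)%N then G n else 0.
have -> : \sum_(k < K) \sum_(i < b | (i + s < b)%N) G (b * k + i)%N =
  \sum_(0 <= n < K * b) H n.
  rewrite big_nat_mul big_mkord; apply: eq_bigr => k _.
  rewrite [LHS]big_mkcond -{1}[(k * b)%N]add0n big_addn mulSn addnK big_mkord.
  apply: eq_bigr => i _; rewrite /H [(i + k * b)%N]addnC modnMDl modn_small//.
  by rewrite [(b * k)%N]mulnC.
rewrite [(b * K)%N]mulnC -(big_mkord xpredT G).
rewrite (@big_cat_nat _ _ _ (K * b - s))//= ?leq_subr//.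
rewrite [X in _ + X]big_nat_cond [X in _ + X]big1 ?addr0; last first.
  move=> n; rewrite andbT => /andP[n1 n2]; rewrite /H; case: ifPn => // ns.
  exfalso; move: n1; rewrite leq_subLR leqNgt => /negP; apply.
  have b0 : (0 < b)%N by exact: leq_ltn_trans (leq0n _) ns.
  have nK : (n %/ b < K)%N by rewrite ltn_divLR.
  rewrite {1}(divn_eq n b) addnC -addnA (@leq_trans ((n %/ b).+1 * b))//.
    by rewrite mulSn addnC ltn_add2r.
  by rewrite leq_mul2r nK orbT.
by apply: ler_sum => n _; rewrite /H; case: ifPn.
Qed.

(** Symmetry reduces to the pairs [i < i'] at the price of a factor 2; grouped by [s = i' - i],
    these form [b - 1] sums, each at most [C]. *)
Lemma sum_offdiag_blocks_le (b K : nat) (G : nat -> nat -> R) (C : R) :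
  (forall n m, G n m = G m n) -> (forall n m, 0 <= G n m) -> (0 < b)%N ->
  (forall s, (0 < s < b)%N -> \sum_(n < b * K - s) G n (n + s)%N <= C) ->
  \sum_(k < K) \sum_(i < b) \sum_(i' < b | i' != i) G (b * k + i)%N (b * k + i')%N
  <= 2 * (b.-1%:R * C).
Proof.
move=> Gsym G0 b0 GC.
pose U := \sum_(k < K) \sum_(i < b) \sum_(i' < b | (i < i')%N)
  G (b * k + i)%N (b * k + i')%N.
have -> : \sum_(k < K) \sum_(i < b) \sum_(i' < b | i' != i)
    G (b * k + i)%N (b * k + i')%N = U + U.
  rewrite /U -big_split/=; apply: eq_bigr => k _.
  rewrite [X in _ = _ + X](exchange_big_dep xpredT)//= -big_split/=.
  apply: eq_bigr => i _; rewrite [LHS](bigID (fun i' : 'I_b => (i < i')%N))/=.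
  congr (_ + _).
    by apply: eq_bigl => i'; rewrite -val_eqE/=; case: ltngtP.
  apply: eq_big => [i'|i' _]; last exact: Gsym.
  by rewrite -val_eqE/=; case: ltngtP.
suff H : U <= b.-1%:R * C by rewrite mulrDl mul1r lerD.
(* The difference [s = i' - i] replaces [i'] as summation index. *)
have -> : U = \sum_(1 <= s < b) \sum_(k < K) \sum_(i < b | (i + s < b)%N)
    G (b * k + i)%N (b * k + i + s)%N.
  rewrite [RHS]exchange_big/=; apply: eq_bigr => k _.
  rewrite [RHS](exchange_big_dep xpredT)//=; apply: eq_bigr => i _.
  rewrite (eq_bigl (fun i' : 'I_b => (i.+1 <= i')%N))//.
  rewrite -(big_mkord (fun i' => (i.+1 <= i')%N) (fun i' => G (b * k + i)%N (b * k + i')%N)).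
  rewrite -[LHS](@big_nat_widenl _ _ _ i.+1 0 b xpredT (fun i' => G (b * k + i)%N (b * k + i')%N))//.
  rewrite -addn1 addnC big_addn.
  rewrite [RHS](_ : _ = \sum_(1 <= s < b - i) G (b * k + i)%N (b * k + i + s)%N).
    by apply: eq_bigr => s _; rewrite -addnA [(s + i)%N]addnC.
  rewrite (@big_nat_widen _ _ _ _ (b - i) b) ?leq_subr//=.
  by apply: eq_bigl => s; rewrite ltn_subRL addnC.
apply: (@le_trans _ _ (\sum_(1 <= s < b) C)).
  rewrite !big_nat; apply: ler_sum => s sb.
  apply: le_trans (GC s sb).
  by apply: (@sum_blocks_shift_le b K s (fun n => G n (n + s)%N)).
by rewrite sumr_const_nat subn1 mulr_natl.
Qed.

End block_sums.

(** * Deviation of a child cell from its parent, bounded by the modulus *)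

Section levels.
Context {R : realType}.
Local Notation mu := (@lebesgue_measure R).
Variable b : nat.
Hypothesis b1 : (1 < b)%N.
Local Notation mesh := (@adic_mesh R b).

(** The distance from the first to the last of the [b] children of a cell of width [mesh j], that
    is, the largest shift between siblings. *)
Definition adic_gap (j : nat) : R := (1 - b%:R^-1) * mesh j.
Local Notation gap := adic_gap.

Lemma base_sub_gt0 : 0 < 1 - b%:R^-1 :> R.
Proof. by rewrite subr_gt0 invf_lt1 ?base_gt0// ltr1n. Qed.

Lemma gap_gt0 j : 0 < gap j.
Proof. by rewrite mulr_gt0 ?mesh_gt0// base_sub_gt0. Qed.

Lemma gapE j : gap j = (b%:R - 1) * mesh j.+1.
Proof.
rewrite /adic_gap (meshS b1) mulrA mulrBl mul1r mulVf// gt_eqF//.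
exact: base_gt0.
Qed.

Lemma omega_ge0 p (f : R -> R) (t : R) : 0 < t -> (0 <= omega p f t)%E.
Proof.
move=> t0; apply: (@le_trans _ _ (LpD `[0, 1 - t] p (fun x => f (x + t) - f x))).
  exact: Lnorm_ge0.
by apply: ereal_sup_ubound; exists t => //=; rewrite in_itv/= t0 lexx.
Qed.

Lemma omega_le p (f : R -> R) (s t : R) : s <= t -> (omega p f s <= omega p f t)%E.
Proof.
move=> st; apply: le_ereal_sup => _ [h /= hs <-]; exists h => //=.
by move: hs; rewrite !in_itv/= => /andP[-> /= hs]; rewrite (le_trans hs).
Qed.

(** Here [e] stands for [1/p] and [T] for [2 ^ (1/p)]. The exponents of [b] on the left add up to
    [alpha * (j + 1) - 1], and the [-1] turns [b - 1] into [1 - 1/b]. *)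
Lemma level_weight (alpha e T w : R) j :
  (b%:R `^ (alpha - e + 2^-1)) ^+ j.+1 *
    (b%:R `^ (j.+1%:R / 2 - 1) * (T * (b%:R - 1) * mesh j.+1 `^ (1 - e) * w)) =
  T * (1 - b%:R^-1) * b%:R `^ alpha * ((b%:R `^ alpha) ^+ j * w).
Proof.
have B0 : b%:R != 0 :> R by rewrite gt_eqF// base_gt0.
have Bge0 : 0 <= b%:R :> R by [].
have imp (x y : R) : (x + y == 0) ==> (b%:R != 0 :> R) by rewrite B0 implybT.
have meshE : mesh j.+1 = b%:R `^ (- j.+1%:R) by rewrite powR_invn.
have -> : mesh j.+1 `^ (1 - e) = b%:R `^ (- j.+1%:R * (1 - e)) by rewrite meshE -powRrM.
rewrite -!powR_mulrn ?powR_ge0// -!powRrM.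
have -> : 1 - b%:R^-1 = (b%:R - 1) * b%:R `^ (-1) :> R.
  by rewrite powR_inv1// mulrBl mul1r mulfV.
set X := b%:R `^ _; set Y := b%:R `^ _; set Z := b%:R `^ (_ * (1 - e)).
transitivity (T * (b%:R - 1) * w * (X * Y * Z)); first by ring.
transitivity (T * (b%:R - 1) * w * (b%:R `^ (-1) * b%:R `^ alpha * b%:R `^ (alpha * j%:R))); last by ring.
congr (_ * _); rewrite /X /Y /Z -!powRD//; congr (_ `^ _).
by rewrite -natr1; field.
Qed.

Variable f : R -> R.
Hypothesis fi : mu.-integrable [set: R] (EFin \o f).

Lemma LpD_le_omega p j s : (0 < s < b)%N ->
  (LpD `[0%R, (1 - mesh j.+1 * s%:R)%R] p (fun x => f (x + mesh j.+1 * s%:R) - f x)%R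
   <= omega p f (gap j))%E.
Proof.
move=> /andP[s0 sb]; apply: ereal_sup_ubound; exists (mesh j.+1 * s%:R) => //=.
rewrite in_itv/= mulr_gt0 ?mesh_gt0 ?ltr0n//= gapE mulrC ler_wpM2r ?(ltW (mesh_gt0 _ _))//.
by rewrite lerBrDr natr1 ler_nat.
Qed.

(** The parent integral is the sum over its [b] children; subtracted termwise from [b] copies of one
    child, it leaves only [b - 1] differences, since the term [i' = i] vanishes. *)
Lemma cell_int_child_deviation j k i :
  b%:R * cell_int f (mesh j.+1) (b * k + i) - cell_int f (mesh j) k =
  \sum_(i' < b | i' != i :> nat)
    (cell_int f (mesh j.+1) (b * k + i) - cell_int f (mesh j.+1) (b * k + i')).
Proof.
rewrite (meshS b1 j) cell_int_split ?(ltW (mesh_gt0 _ _))//.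
have -> : b%:R * cell_int f (mesh j.+1) (b * k + i) =
    \sum_(i' < b) cell_int f (mesh j.+1) (b * k + i).
  by rewrite sumr_const card_ord mulr_natl.
rewrite -sumrB [LHS](bigID (fun i' : 'I_b => i' != i :> nat))/=.
rewrite [X in _ + X]big1 ?addr0// => i' /negPn/eqP ->.
by rewrite subrr.
Qed.

(** Jensen over the [b - 1] siblings costs [(b - 1) ^ (r - 1)], and the sum over ordered pairs
    contributes [2 * (b - 1)]. *)
Lemma sum_child_deviation_powR_le j (r w : R) : 1 <= r -> 0 <= w ->
  (omega r%:E f (gap j) <= w%:E)%E ->
  \sum_(k < b ^ j) \sum_(i < b) `|b%:R * cell_int f (mesh j.+1) (b * k + i)
     - cell_int f (mesh j) k| `^ r <=
  2 * (b%:R - 1) `^ r * mesh j.+1 `^ (r - 1) * w `^ r.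
Proof.
move=> r1 w0 ow; have r0 : 0 < r by rewrite (lt_le_trans _ r1).
have B1 : 0 < b%:R - 1 :> R by rewrite subr_gt0 ltr1n.
pose G n m := `|cell_int f (mesh j.+1) n - cell_int f (mesh j.+1) m| `^ r.
apply: (@le_trans _ _ (\sum_(k < b ^ j) \sum_(i < b)
  ((b%:R - 1) `^ (r - 1) * \sum_(i' < b | i' != i) G (b * k + i)%N (b * k + i')%N))).
  apply: ler_sum => k _; apply: ler_sum => i _.
  apply: le_trans (@powR_sum_le _ _ (fun i' => i' != i) _ _ (b%:R - 1) r1 B1 _ _) => //.
    rewrite ge0_ler_powR ?nnegrE ?sumr_ge0 ?(ltW r0)//.
    by rewrite cell_int_child_deviation ler_norm_sum.
  by rewrite cardC1 card_ord -[in leRHS](prednK (ltnW b1)) -natr1 addrK.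
under eq_bigr do rewrite -mulr_sumr.
rewrite -mulr_sumr.
have H : \sum_(k < b ^ j) \sum_(i < b) \sum_(i' < b | i' != i)
    G (b * k + i)%N (b * k + i')%N <=
    2 * (b.-1%:R * (mesh j.+1 `^ (r - 1) * w `^ r)).
  apply: (@sum_offdiag_blocks_le R b (b ^ j) G).
  - by move=> n m; rewrite /G distrC.
  - by move=> n m; rewrite powR_ge0.
  - exact: ltnW.
  - move=> s sb; under eq_bigr do rewrite /G distrC.
    apply: sum_cell_int_dist_powR => //; first exact: mesh_gt0.
      apply: mesh_mul_le1 => //; rewrite subnK ?expnS//.
      by case/andP: sb => _ /ltnW sb; rewrite (leq_trans sb)// leq_pmulr// expn_gt0 ltnW.
    exact: le_trans (LpD_le_omega _ _ sb) ow.
apply: le_trans (ler_wpM2l (powR_ge0 _ _) H) _.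
have -> : b.-1%:R = b%:R - 1 :> R by rewrite -[in RHS](prednK (ltnW b1)) -natr1 addrK.
rewrite -(mulr_powRB1 (ltW B1) r0) le_eqVlt; apply/orP; left; apply/eqP; ring.
Qed.

Lemma child_deviation_le j k i (w : R) : 0 <= w -> (k < b ^ j)%N -> (i < b)%N ->
  (omega +oo f (gap j) <= w%:E)%E ->
  `|b%:R * cell_int f (mesh j.+1) (b * k + i) - cell_int f (mesh j) k| <=
  (b%:R - 1) * mesh j.+1 * w.
Proof.
move=> w0 kb ib ow; rewrite cell_int_child_deviation.
(* Shifts are natural multiples of the mesh, so pairs are ordered first; the other order follows by
   symmetry of the distance. *)
have D (m n : nat) : (m < n)%N -> (n < b)%N ->
    `|cell_int f (mesh j.+1) (b * k + n) - cell_int f (mesh j.+1) (b * k + m)|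
    <= mesh j.+1 * w.
  move=> mn nb; have := @cell_int_dist_LpDy _ _ fi (mesh j.+1) (n - m) (b * k + m) w.
  rewrite -addnA subnKC ?(ltnW mn)//; apply => //; first exact: mesh_gt0.
    apply: mesh_mul_le1 => //; rewrite addSn -addnA subnKC ?(ltnW mn)// expnS.
    by rewrite (@leq_trans (b * k.+1))// ?leq_mul2l ?kb ?orbT// mulnS addnC ltn_add2r.
  apply: le_trans ow; apply: LpD_le_omega.
  by rewrite subn_gt0 mn (leq_ltn_trans (leq_subr _ _)).
apply: (le_trans (ler_norm_sum _ _ _)).
apply: (@le_trans _ _ (\sum_(i' < b | i' != i :> nat) (mesh j.+1 * w))).
  apply: ler_sum => i' i'i; case: (ltngtP i' i) i'i => // ii' _; first exact: D.
  by rewrite distrC D.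
rewrite sumr_const -[leLHS]mulr_natl mulrA ler_wpM2r// ler_wpM2r ?(ltW (mesh_gt0 _ _))//.
rewrite lerBrDr natr1 ler_nat.
have -> : #|[pred i' : 'I_b | (i' : nat) != i]| = #|predC1 (Ordinal ib)|.
  by apply: eq_card => x; rewrite !inE.
by rewrite cardC1 card_ord prednK// ltnW.
Qed.

End levels.

(** * Comparison of [l_q] norms of sequences *)

Section lq_sequences.
Context {R : realType}.
Implicit Types (q : \bar R) (a c : nat -> \bar R).
Local Open Scope ereal_scope.

Lemma ge0_le_poweR (r : R) (x y : \bar R) : (0 <= r)%R -> 0 <= x -> x <= y ->
  poweR x r <= poweR y r.
Proof.
move=> r0 x0 xy; apply: gt0_ler_poweR; rewrite ?in_itv/= ?leey ?andbT//.
exact: le_trans xy.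
Qed.

Lemma lq_seq_le q a c : 1 <= q -> (forall j, 0 <= a j) ->
  (forall j, a j <= c j) -> lq_seq q a <= lq_seq q c.
Proof.
case: q => [r| |]// => [r1|_] a0 ac.
- rewrite lee_fin in r1; have r0 : (0 < r)%R by rewrite (lt_le_trans _ r1).
  rewrite /lq_seq ge0_le_poweR ?invr_ge0 ?(ltW r0)//.
    by apply: nneseries_ge0 => j _ _; exact: poweR_ge0.
  apply: lee_nneseries => [j _ _|j _]; first exact: poweR_ge0.
  by rewrite ge0_le_poweR ?(ltW r0).
- apply: ge_ereal_sup => _ [j _ <-]; apply: (le_trans (ac j)).
  by apply: ereal_sup_ubound; exists j.
Qed.

Lemma lq_seq_ge0 q a : (forall j, 0 <= a j) -> 0 <= lq_seq q a.
Proof.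
case: q => [r| |]//= a0; first exact: poweR_ge0.
by apply: (le_trans (a0 0%N)); apply: ereal_sup_ubound; exists 0%N.
Qed.

(** Term 0 is split off by [poweR_add_le], and the tail is compared by monotonicity and homogeneity.
    The shift reflects that level [j + 1] of the wavelet norm is governed by term [j] of the modulus
    sequence. *)
Lemma lq_seq_shift_le q a c (A : \bar R) (K : R) : 1 <= q -> (0 <= K)%R ->
  (forall j, 0 <= a j) -> (forall j, 0 <= c j) ->
  a 0%N <= A -> (forall j, a j.+1 <= K%:E * c j) ->
  lq_seq q a <= A + K%:E * lq_seq q c.
Proof.
move=> q1 K0 a0 c0 aA aK; have A0 : 0 <= A := le_trans (a0 0%N) aA.
have KE0 : 0 <= K%:E by rewrite lee_fin.
case: q q1 => [r| |]// => [r1|_].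
- rewrite lee_fin in r1; have r0 : (0 < r)%R by rewrite (lt_le_trans _ r1).
  have S0 : 0 <= \sum_(0 <= j <oo) poweR (c j) r.
    by apply: nneseries_ge0 => j _ _; exact: poweR_ge0.
  have -> : K%:E * lq_seq r%:E c =
      poweR ((K `^ r)%:E * \sum_(0 <= j <oo) poweR (c j) r) r^-1.
    rewrite poweRM ?lee_fin ?powR_ge0// poweR_EFin -powRrM mulfV ?gt_eqF//.
    by rewrite powRr1.
  apply: le_trans (poweR_add_le r1 A0 _); last first.
    by rewrite mule_ge0 ?lee_fin ?powR_ge0.
  rewrite /lq_seq ge0_le_poweR ?invr_ge0 ?(ltW r0)//.
    by apply: nneseries_ge0 => j _ _; exact: poweR_ge0.
  rewrite nneseries_recl// => [|j _]; last exact: poweR_ge0.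
  apply: leeD; first by rewrite ge0_le_poweR ?(ltW r0).
  rewrite -nneseries_addn => [|j]; last exact: poweR_ge0.
  rewrite -nneseriesZl => [|j _]; last exact: poweR_ge0.
  apply: lee_nneseries => [j _ _|j _]; first exact: poweR_ge0.
  rewrite addn1 -poweR_EFin -poweRM// ge0_le_poweR ?(ltW r0)//.
- have c00 : 0 <= lq_seq +oo c by exact: lq_seq_ge0.
  apply: ge_ereal_sup => _ [[|j] _ <-].
    by apply: (le_trans aA); rewrite leeDl// mule_ge0.
  apply: (le_trans (aK j)); rewrite -[leLHS]add0e leeD// lee_wpmul2l//.
  by apply: ereal_sup_ubound; exists j.
Qed.

End lq_sequences.

(** * Weighted bounds for each wavelet level *)

Section wavelet_levels.
Context {R : realType}.
Local Notation mu := (@lebesgue_measure R).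
Variable b : nat.
Hypothesis b1 : (1 < b)%N.
Variable alpha : R.
Local Notation mesh := (@adic_mesh R b).
Local Notation gap := (@adic_gap R b).

Definition wav_level p (f : R -> R) (j : nat) : \bar R :=
  (((b%:R `^ (alpha - inv_exp p + 2^-1)) ^+ j)%:E *
    lp_fin p (nDelta b j) (nNabla b j) (fun k i => `|haar_coef b f j k i|))%E.

Lemma lp_fin_ge0 (p : \bar R) m n (c : nat -> nat -> \bar R) :
  (0 <= lp_fin p m n c)%E.
Proof.
case: p => [r| |]//=; first exact: poweR_ge0.
exact: bigmax_ge_id.
Qed.

Lemma wav_level_ge0 p f j : (0 <= wav_level p f j)%E.
Proof.
by rewrite mule_ge0 ?lp_fin_ge0// lee_fin exprn_ge0// powR_ge0.
Qed.

(** The sequence of the discrete Besov norm, with the argument [b ^ (-j)] of the modulus shrunk to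
    [gap j]. *)
Definition gap_omega p (f : R -> R) (j : nat) : \bar R :=
  (((b%:R `^ alpha) ^+ j)%:E * omega p f (gap j))%E.

Lemma gap_omega_ge0 p f j : (0 <= gap_omega p f j)%E.
Proof.
by rewrite mule_ge0 ?omega_ge0 ?gap_gt0// lee_fin exprn_ge0// powR_ge0.
Qed.

Variable f : R -> R.
Hypothesis fi : mu.-integrable [set: R] (EFin \o f).

(** The only coefficient of level zero is the mean of [f] over the unit cell, so Jensen on that cell
    suffices. *)
Lemma wav_level0_le p : (1 <= p)%E -> (wav_level p f 0 <= LpD `[0%R, 1%R] p f)%E.
Proof.
move=> p1.
have -> : wav_level p f 0 = `|cell_int f 1 0|%:E.
  rewrite /wav_level expr0 mul1e /lp_fin /=.
  case: p p1 => [r| |]// => [r1|_].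
    rewrite !big_ord1 haar_coef0//= -powRrM mulfV ?powRr1//.
    by rewrite lee_fin in r1; rewrite gt_eqF// (lt_le_trans _ r1).
  rewrite !big_ord_recl !big_ord0 haar_coef0//=.
  have H : (maxe `|cell_int f 1 0|%:E 0 = `|cell_int f 1 0|%:E)%E by apply: max_l; rewrite lee_fin.
  by rewrite !H.
have i01 := @integrableS _ _ _ mu _ _ _ measurableT (measurable_cell 1 0) (@subsetT _ _) fi.
have n0 : 0 <= \int[mu]_(x in cell 1 0) `|f x| by exact: Rintegral_ge0.
have : `|cell_int f 1 0| <= \int[mu]_(x in cell 1 0) `|f x|.
  by apply: le_normr_Rintegral => //; exact: measurable_cell.
rewrite -lee_fin => /le_trans; apply.
have : (0 <= LpD `[0%R, 1%R] p f)%E by exact: Lnorm_ge0.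
case E : (LpD _ _ _) => [w| |]//; last by move=> _; exact: leey.
rewrite !lee_fin => w0.
case: p p1 E => [r| |]// => [r1|_] E.
- rewrite lee_fin in r1; have r0 : 0 < r by rewrite (lt_le_trans _ r1).
  have := @sum_cell_powR_le_LpD _ f fi 1 1 1 r w ltr01 r1 w0.
  rewrite E lexx mulr1 lexx => /(_ isT isT).
  rewrite big_ord1 powR1 mul1r => H.
  rewrite leNgt; apply/negP => wn; move: H; apply/negP; rewrite -ltNge.
  by apply: gt0_ltr_powR; rewrite ?nnegrE.
- have := @cell_le_LpDy _ f fi 1 0 1 w ltr01 w0.
  by rewrite E lexx mulr1 mul1r lexx; exact.
Qed.

Lemma wav_levelS_le p j : (1 <= p)%E ->
  (wav_level p f j.+1 <=
   (2 `^ inv_exp p * (1 - b%:R^-1) * b%:R `^ alpha)%:E * gap_omega p f j)%E.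
Proof.
move=> p1; set K := 2 `^ _ * _ * _.
have K0 : 0 < K by rewrite !mulr_gt0 ?powR_gt0 ?base_gt0// base_sub_gt0.
have Ba0 : 0 < (b%:R `^ alpha) ^+ j :> R by rewrite exprn_gt0 ?powR_gt0 ?base_gt0.
have := @omega_ge0 _ p f (gap j) (gap_gt0 b1 j).
(* If the modulus is infinite, so is the right side, because [K] and the weight are positive. *)
rewrite /gap_omega; case E : (omega p f (gap j)) => [w| |]//; last first.
  by move=> _; rewrite !gt0_muley ?lte_fin// leey.
rewrite lee_fin => w0; rewrite /wav_level.
have c0 : 0 <= b%:R `^ (j.+1%:R / 2 - 1) :> R by rewrite powR_ge0.
have B1 : 0 <= b%:R - 1 :> R by rewrite subr_ge0 ler1n ltnW.
suff H : (lp_fin p (nDelta b j.+1) (nNabla b j.+1) (fun k i => `|haar_coef b f j.+1 k i|) <=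
   (b%:R `^ (j.+1%:R / 2 - 1) * (2 `^ inv_exp p * (b%:R - 1) * mesh j.+1 `^ (1 - inv_exp p) * w))%:E)%E.
  have := lee_wpmul2l _ H; move=> /(_ ((b%:R `^ (alpha - inv_exp p + 2^-1)) ^+ j.+1)%:E).
  rewrite lee_fin exprn_ge0 ?powR_ge0// => /(_ isT) /le_trans; apply.
  by rewrite -!EFinM level_weight.
have d0 : 0 < mesh j.+1 by exact: mesh_gt0.
clear K K0; case: p p1 E => [r| |]// => [r1|_] E /=.
- rewrite lee_fin in r1; have r0 : 0 < r by rewrite (lt_le_trans _ r1).
  set c := b%:R `^ _.
  have H := @sum_child_deviation_powR_le _ _ b1 f fi j r w r1 w0; rewrite E lexx in H.
  have {H} := H isT; set S := \sum_(k < _) _ => H.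
  have -> : (\sum_(k < b ^ j) \sum_(i < b) (poweR `|haar_coef b f j.+1 k i| r))%E =
      (c `^ r * S)%:E.
    rewrite /S mulr_sumr -sumEFin; apply: eq_bigr => k _.
    rewrite mulr_sumr -sumEFin; apply: eq_bigr => i _.
    by rewrite haar_coefS//= normrM powRM// ger0_norm.
  rewrite poweR_EFin lee_fin powRM ?powR_ge0//; last first.
    by rewrite sumr_ge0// => k _; rewrite sumr_ge0// => i _; exact: powR_ge0.
  rewrite -powRrM mulfV ?gt_eqF// powRr1//; apply: ler_wpM2l => //.
  apply: (@le_trans _ _ ((2 * (b%:R - 1) `^ r * mesh j.+1 `^ (r - 1) * w `^ r) `^ r^-1)).
    rewrite ge0_ler_powR ?nnegrE ?invr_ge0 ?(ltW r0)//.
      by rewrite sumr_ge0// => k _; rewrite sumr_ge0// => i _; exact: powR_ge0.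
    by rewrite !mulr_ge0 ?powR_ge0.
  (* The [r]-th root turns [mesh ^ (r - 1)] into [mesh ^ (1 - 1/r)] and the factor 2 into
     [2 ^ (1/r)]. *)
  rewrite !powRM ?mulr_ge0 ?powR_ge0// -!powRrM mulfV ?gt_eqF// !powRr1//.
  by rewrite mulrBl mul1r mulfV ?gt_eqF.
(* A maximum starts from 0, so the bound must also be nonnegative. As [1/p = 0] here, it reduces to
   [(b - 1) * mesh j.+1 * w]. *)
- apply/bigmax_leP; split => [|k _].
    by rewrite lee_fin subr0 powRr0 powRr1 ?(ltW d0)// !mulr_ge0// ltW.
  apply/bigmax_leP; split => [|i _].
    by rewrite lee_fin subr0 powRr0 powRr1 ?(ltW d0)// !mulr_ge0// ltW.
  rewrite haar_coefS//= lee_fin normrM ger0_norm// ler_wpM2l//.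
  rewrite subr0 powRr0 mul1r powRr1 ?(ltW d0)//.
  by apply: child_deviation_le => //; rewrite E.
Qed.
End wavelet_levels.

(** * Finiteness of the gap sequence from the continuous seminorm *)

Section continuous_seminorm.
Context {R : realType}.
Local Notation mu := (@lebesgue_measure R).
Variable b : nat.
Hypothesis b1 : (1 < b)%N.
Variable alpha : R.
Hypothesis alpha0 : 0 <= alpha.
Local Notation mesh := (@adic_mesh R b).
Local Notation gap := (@adic_gap R b).

Lemma mesh_le1 j : mesh j <= 1.
Proof.
rewrite /adic_mesh invf_le1 ?exprn_gt0 ?(base_gt0 b1)//.
by rewrite exprn_ege1// ler1n ltnW.
Qed.

(** From [b >= 2], [gap i = (b - 1) * mesh i.+1] is at least [mesh i.+1]. This makes the intervals
    []gap j, mesh j[] disjoint. *)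
Lemma mesh_le_gap i j : (i < j)%N -> mesh j <= gap i.
Proof.
move=> ij; apply: (@le_trans _ _ (mesh i.+1)).
  by rewrite /adic_mesh lef_pV2 ?posrE ?exprn_gt0 ?(base_gt0 b1)// ler_eXn2l// ltr1n.
rewrite gapE// ler_peMl ?(ltW (mesh_gt0 _ _))// lerBrDr.
by rewrite (_ : 1 + 1 = 2%:R) ?ler_nat.
Qed.

Lemma gap_lt_mesh j : gap j < mesh j.
Proof.
rewrite /adic_gap gtr_pMl ?mesh_gt0// ltrBlDr ltrDl invr_gt0; exact: base_gt0.
Qed.

Lemma mesh_sub_gap j : mesh j - gap j = mesh j / b%:R.
Proof. by rewrite /adic_gap mulrBl mul1r opprB addrC subrK mulrC. Qed.

(** The modulus is nondecreasing, so the preimage of a ray [[r, +oo]] is an interval. *)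
Lemma measurable_omega p (f : R -> R) : measurable_fun [set: R] (omega p f).
Proof.
apply: (measurability _ (ErealGenCInfty.measurableE R)) => // _ [_ [r ->] <-].
apply: measurableI => //; apply: is_interval_measurable => s t/=.
rewrite !in_itv/= !andbT => fs ft u /andP[su ut].
by rewrite in_itv/= andbT (le_trans fs)// omega_le.
Qed.

(** Each factor is compared separately: [t < mesh j] gives [b ^ (alpha * j) <= t ^ (- alpha)], and
    [gap j < t] gives the bound on the modulus. *)
Lemma gap_omega_le p (f : R -> R) j (t : R) : t \in `]gap j, mesh j[ ->
  (gap_omega b alpha p f j <= (t `^ (- alpha))%:E * omega p f t)%E.
Proof.
rewrite in_itv/= => /andP[t1 t2]; have t0 : 0 < t := lt_trans (gap_gt0 b1 j) t1.
have B0 := @base_gt0 R b b1.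
apply: lee_pmul; rewrite ?omega_ge0 ?gap_gt0 ?omega_le ?(ltW t1)//.
rewrite lee_fin powRN -powR_mulrn ?powR_ge0// -powRrM mulrC powRrM powR_mulrn ?(ltW B0)//.
rewrite -[b%:R ^+ j]invrK -/(mesh j) -powR_inv1 ?(ltW (mesh_gt0 _ _))//.
rewrite -powRrM mulN1r powRN lef_pV2 ?posrE ?powR_gt0 ?mesh_gt0//.
by rewrite ge0_ler_powR ?nnegrE ?(ltW t0) ?(ltW t2) ?(ltW (mesh_gt0 _ _)).
Qed.

Lemma lq_gap_omega_lty p q (f : R -> R) : (1 <= q)%E ->
  (besov_seminorm_cont alpha p q f < +oo)%E ->
  (lq_seq q (gap_omega b alpha p f) < +oo)%E.
Proof.
have B0 := @base_gt0 R b b1.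
case: q => [r| |]// => [r1|_].
- rewrite lee_fin in r1; have r0 : 0 < r by rewrite (lt_le_trans _ r1).
  pose F (t : R) := (poweR ((t `^ (- alpha))%:E * omega p f t) r * (t^-1)%:E)%E.
  rewrite /besov_seminorm_cont -/(F _) => /lty_poweRy; rewrite invr_eq0 gt_eqF// => /(_ isT) I.
  rewrite /lq_seq poweR_lty//.
  pose A (j : nat) : set R := `]gap j, mesh j[%classic.
  have mA j : measurable (A j) by exact: measurable_itv.
  have A01 j : A j `<=` `]0, 1].
    move=> t; rewrite /A/= !in_itv/= => /andP[t1 t2].
    by rewrite (lt_trans (gap_gt0 b1 j) t1) (le_trans (ltW t2) (mesh_le1 _)).
  have F0 (t : R) : `]0, 1]%classic t -> (0 <= F t)%E.
    rewrite /= in_itv/= => /andP[t0 _]; rewrite mule_ge0 ?poweR_ge0// lee_fin.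
    by rewrite invr_ge0 ltW.
  (* On []0, 1]] the inverse [t^-1] equals the real power with exponent [-1], whose measurability is
     available. *)
  have mF : measurable_fun (`]0, 1]%classic : set R) F.
    have : measurable_fun (`]0, 1]%classic : set R) (fun t : R =>
        (poweR ((t `^ (- alpha))%:E * omega p f t) r * (t `^ (-1))%:E)%E).
      apply: emeasurable_funM.
        apply: (measurableT_comp (measurable_poweR r)).
        apply: emeasurable_funM.
          by apply/measurable_EFinP; apply: measurable_funTS; exact: measurable_powR.
        by apply: measurable_funTS; exact: measurable_omega.
      by apply/measurable_EFinP; apply: measurable_funTS; exact: measurable_powR.
    apply: eq_measurable_fun => t; rewrite inE/= in_itv/= => /andP[t0 _].
    by rewrite /F powR_inv1// ltW.
  have tA : trivIset setT A.
    apply: ltn_trivIset => m n nm; apply/seteqP; split => // t [].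
    rewrite /A/= !in_itv/= => /andP[t1 t2] /andP[t3 t4].
    by move: (lt_trans t1 t4); rewrite ltNge mesh_le_gap.
  have D01 : \bigcup_j A j `<=` `]0, 1] by move=> t [j _ At]; exact: A01 At.
  have mD : measurable (\bigcup_j A j) by exact: bigcup_measurable.
  have SI : (\sum_(0 <= j <oo) \int[mu]_(t in A j) F t <= \int[mu]_(t in `]0%R, 1%R]) F t)%E.
    rewrite -ge0_integral_bigcup//.
    - exact: ge0_subset_integral.
    - exact: measurable_funS mF.
    - by move=> t /D01; exact: F0.
  (* The constant [1/b] is the length [mesh j / b] of [A j] times the lower bound [1 / mesh j] of
     [1 / t] there. *)
  have : ((b%:R^-1)%:E * \sum_(0 <= j <oo) poweR (gap_omega b alpha p f j) r < +oo)%E.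
    apply: le_lt_trans I; apply: le_trans SI.
    rewrite -nneseriesZl => [|j _]; last exact: poweR_ge0.
    apply: lee_nneseries => [j _ _|j _].
      by rewrite mule_ge0 ?poweR_ge0// lee_fin invr_ge0 ltW.
    have -> : ((b%:R^-1)%:E * poweR (gap_omega b alpha p f j) r =
      \int[mu]_(t in A j) (cst (poweR (gap_omega b alpha p f j) r * ((mesh j)^-1)%:E)) t)%E.
      have muA : mu (A j) = (mesh j / b%:R)%:E.
        by rewrite /A lebesgue_measure_itv/= lte_fin gap_lt_mesh -EFinB mesh_sub_gap.
      have cA x : (\int[mu]_(t in A j) cst x t = x * (mesh j / b%:R)%:E)%E.
        by rewrite -muA; apply: (@integral_cst _ _ _ mu (A j)); exact: mA.
      rewrite cA.
      rewrite -muleA -EFinM mulKf ?gt_eqF ?mesh_gt0//.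
      by rewrite muleC.
    apply: ge0_le_integral => //.
    - exact: mA.
    - by move=> t _ /=; rewrite mule_ge0 ?poweR_ge0// lee_fin invr_ge0 ltW ?mesh_gt0.
    - exact: measurable_funS mF.
    - move=> t At; have t0 : 0 < t by move: (A01 _ _ At); rewrite /= in_itv/= => /andP[].
      apply: lee_pmul; rewrite ?poweR_ge0 ?lee_fin ?invr_ge0 ?(ltW (mesh_gt0 _ _))//.
        apply: ge0_le_poweR; rewrite ?(ltW r0) ?gap_omega_ge0//.
        exact: gap_omega_le.
      move: At; rewrite /A/= in_itv/= => /andP[_ tm].
      by rewrite lef_pV2 ?posrE ?mesh_gt0 ?ltW.
  set S := (\sum_(0 <= j <oo) _)%E; case: S => [s| |]//; first by move=> _; exact: ltry.
  by rewrite gt0_muley// lte_fin invr_gt0.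
- rewrite /besov_seminorm_cont unlock ifT; last exact: lebesgue_measureT_gt0.
  set M := ess_sup _ _ => My; apply: le_lt_trans My.
  apply: ge_ereal_sup => _ [j _ <-].
  have H : \forall t \ae mu, (`|(\1_`]0, 1] t)%:E * ((t `^ (- alpha))%:E * omega p f t)| <= M)%E.
    by apply/ess_supP.
  (* A term above the essential supremum [M] would put all of []gap j, mesh j[], which has positive
     length, inside the exceptional null set. *)
  rewrite leNgt; apply/negP => Mlt.
  case: H => N [mN N0 sN].
  have : (mu `]gap j, mesh j[ <= mu N)%E.
    apply: le_measure; rewrite ?inE//.
    apply: subset_trans sN => t /= At tM; move: Mlt; apply/negP; rewrite -leNgt.
    apply: le_trans tM; have : `]0, 1]%classic t.
      move: At; rewrite /= !in_itv/= => /andP[t1 t2].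
      by rewrite (lt_trans (gap_gt0 b1 j) t1) (le_trans (ltW t2) (mesh_le1 _)).
    move=> t01; rewrite indicE mem_set// mul1e.
    by apply: le_trans (gap_omega_le p f At) (lee_abs _).
  rewrite N0 lebesgue_measure_itv/= lte_fin gap_lt_mesh -EFinB lee_fin.
  by rewrite subr_le0 leNgt gap_lt_mesh.
Qed.
End continuous_seminorm.

(** Coefficients [c * a i] of one block are paired with the values of its [b] wavelets at a point of
    child [i0]. The wavelets are linearly dependent, and the zero sum of [a] removes the
    contribution of the [-1]. *)
Lemma sum_centered_delta (R : comRingType) (n : nat) (a : 'I_n -> R) (c : R)
    (i0 : 'I_n) : \sum_i a i = 0 ->
  \sum_i c * a i * (c * (n%:R * (i == i0)%:R - 1)) = c ^+ 2 * n%:R * a i0.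
Proof.
move=> a0; transitivity (\sum_i (c ^+ 2 * n%:R * (a i * (i == i0)%:R) - c ^+ 2 * a i)).
  by apply: eq_bigr => i _; ring.
rewrite sumrB -!mulr_sumr a0 mulr0 subr0 (bigD1 i0)//= eqxx mulr1 big1 ?addr0// => i /negbTE ->.
by rewrite mulr0.
Qed.

(** * Pointwise convergence of the Haar series *)

Section haar_expansion.
Context {R : realType}.
Local Notation mu := (@lebesgue_measure R).
Variable b : nat.
Hypothesis b1 : (1 < b)%N.
Local Notation mesh := (@adic_mesh R b).

Definition cell_index (x : R) (j : nat) : nat := Num.truncn (x * b%:R ^+ j).

Lemma indic_cell (x : R) j n : 0 <= x ->
  \1_(cell (mesh j) n) x = (n == cell_index x j)%:R :> R.
Proof.
move=> x0; have B0 : 0 < b%:R ^+ j :> R by rewrite exprn_gt0 ?(base_gt0 b1).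
rewrite indicE; congr (nat_of_bool _)%:R.
rewrite eq_sym truncn_eq ?mulr_ge0 ?(ltW B0)//.
apply/idP/idP; rewrite inE /cell /= in_itv/= /adic_mesh ![_^-1 * _]mulrC.
  by rewrite ler_pdivrMr// ltr_pdivlMr.
by rewrite ler_pdivrMr// ltr_pdivlMr.
Qed.

Lemma mem_cell_index (x : R) j : 0 <= x -> cell (mesh j) (cell_index x j) x.
Proof.
move=> x0; have /eqP := indic_cell j (cell_index x j) x0.
by rewrite eqxx indicE; case: (boolP (x \in _)) => [/set_mem//|_]; rewrite eq_sym oner_eq0.
Qed.

Lemma cell_index_lt (x : R) j : 0 <= x -> x < 1 -> (cell_index x j < b ^ j)%N.
Proof.
move=> x0 x1; rewrite truncn_lt_nat ?mulr_ge0 ?exprn_ge0//.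
by rewrite natrX gtr_pMl// exprn_gt0 ?(base_gt0 b1).
Qed.

Lemma cell_indexS (x : R) j : 0 <= x -> (cell_index x j.+1 %/ b)%N = cell_index x j.
Proof.
move=> x0; have B0 := @base_gt0 R b b1.
apply/esym/truncn_def.
have := truncn_itv (mulr_ge0 x0 (exprn_ge0 j.+1 (ltW B0))).
rewrite -/(cell_index x j.+1); set n := cell_index x j.+1 => /andP[n1 n2].
rewrite exprSr mulrA in n1 n2.
apply/andP; split.
  rewrite -(ler_pM2r B0) -natrM (le_trans _ n1)// ler_nat; exact: leq_trunc_div.
rewrite -(ltr_pM2r B0) -natrM (lt_le_trans n2)// ler_nat; exact: ltn_ceil (ltnW b1).
Qed.

Variable f : R -> R.
Hypothesis fi : mu.-integrable [set: R] (EFin \o f).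

(** Only the parent cell containing [x] contributes, and [sum_centered_delta] evaluates its block.
    The result is a difference of consecutive cell averages, so that the levels telescope. *)
Lemma haar_level_sum (x : R) j : 0 <= x -> x < 1 ->
  \sum_(k < b ^ j) \sum_(i < b) fine (haar_coef b f j.+1 k i) * haar b j.+1 k i x =
  (mesh j.+1)^-1 * cell_int f (mesh j.+1) (cell_index x j.+1) -
  (mesh j)^-1 * cell_int f (mesh j) (cell_index x j).
Proof.
move=> x0 x1; have B0 := @base_gt0 R b b1.
set c : R := b%:R `^ (j.+1%:R / 2 - 1).
set n := cell_index x j.+1; set k0 := cell_index x j.
set M := cell_int f (mesh j.+1); set M0 := cell_int f (mesh j) k0.
have nk : (n %/ b)%N = k0 by exact: cell_indexS.
have haarE k i : haar b j.+1 k i x = c * (b%:R * (b * k + i == n)%N%:R - (k == k0)%:R).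
  rewrite /haar -/c -/(mesh j.+1) addn1 -/(cell (mesh j.+1) (b * k + i)).
  by rewrite -/(mesh j) -/(cell (mesh j) k) !indic_cell.
have k0b : (k0 < b ^ j)%N by exact: cell_index_lt.
(* Wavelets attached to any other parent cell vanish at [x]. *)
rewrite (bigD1 (Ordinal k0b))// [X in _ + X = _]big1 ?addr0; last first.
  move=> k kk0; rewrite big1// => i _; rewrite haarE.
  have kk : (k == k0 :> nat) = false by apply/negbTE.
  rewrite kk subr0 (_ : (b * k + i == n)%N = false) ?mulr0//.
  apply/negbTE; apply: contraNN kk0 => /eqP kin; apply/eqP/val_inj => /=.
  by rewrite -nk -kin mulnC divnMDl ?(ltnW b1)// divn_small// addn0.
have nE : n = (b * k0 + n %% b)%N by rewrite {1}(divn_eq n b) nk mulnC.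
have nb : (n %% b < b)%N by rewrite ltn_pmod// ltnW.
have MS : M0 = \sum_(i < b) M (b * k0 + i)%N.
  by rewrite /M0 (meshS b1 j) cell_int_split// ltW// mesh_gt0.
have A0 : \sum_(i < b) (b%:R * M (b * k0 + i)%N - M0) = 0.
  by rewrite sumrB -mulr_sumr -MS sumr_const card_ord mulr_natl subrr.
transitivity (c ^+ 2 * b%:R * (b%:R * M (b * k0 + Ordinal nb)%N - M0)).
  rewrite -(sum_centered_delta c (Ordinal nb) A0); apply: eq_bigr => i _.
  rewrite haarE haar_coefS//= eqxx -/c -/M -/M0.
  by rewrite (_ : (b * k0 + i == n)%N = (i == Ordinal nb))// -val_eqE/= {1}nE eqn_add2l.
rewrite -[(b * k0 + _)%N]nE.
(* The factor [c ^ 2 * b = b ^ j] turns [b * M - M0] into a difference of averages over cells of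
   widths [b ^ (-j-1)] and [b ^ (-j)]. *)
have c2 : c ^+ 2 = b%:R ^+ j / b%:R.
  rewrite -powR_mulrn ?powR_ge0// -powRrM.
  have -> : (j.+1%:R / 2 - 1) * 2%:R = j%:R + -1 :> R by rewrite -natr1; field.
  rewrite powRD ?powR_mulrn ?powR_inv1 ?ltW//.
  by apply/implyP => _; rewrite gt_eqF.
rewrite c2 /adic_mesh !invrK exprS; field; by rewrite gt_eqF.
Qed.

Lemma haar_partialS (x : R) J : 0 <= x -> x < 1 ->
  haar_partial b f J.+1 x =
  (mesh J)^-1 * cell_int f (mesh J) (cell_index x J).
Proof.
move=> x0 x1; rewrite /haar_partial; elim: J => [|J IH].
  rewrite !big_ord1/= haar_coef0//= mesh0 invr1 mul1r.
  have -> : cell_index x 0 = 0%N by apply/truncn_def; rewrite expr0 mulr1 x0 x1.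
  by rewrite indicE mem_set ?mulr1//= in_itv/= x0 x1.
rewrite big_ord_recr IH.
rewrite -[RHS](subrK ((mesh J)^-1 * cell_int f (mesh J) (cell_index x J))).
by rewrite -haar_level_sum// addrC.
Qed.

Lemma haar_partial_cvg (x : R) : 0 <= x -> x < 1 -> lebesgue_pt f x ->
  haar_partial b f J x @[J --> \oo] --> f x.
Proof.
move=> x0 x1 fx.
(* The differentiation theorem wants a nicely shrinking family at every real point; the cells
   provide it for [y >= 0], and balls fill in for negative [y]. *)
pose E (y : R) n : set R := if 0 <= y then cell (mesh n) (cell_index y n) else ball y (mesh n).
have hE y : nicely_shrinking y (E y).
  split.
    move=> n; rewrite /E; case: ifP => _; first exact: measurable_cell.
    exact: measurable_ball.
  (* The ball of radius [mesh n] about [y] contains the cell of [y] and has twice its length. *)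
  exists (2, fun n => PosNum (mesh_gt0 b1 n)); split => //=.
  - have -> : mesh = (GRing.exp (b%:R^-1) : nat -> R).
      by apply/funext => n; rewrite /adic_mesh exprVn.
    apply: cvg_expr; rewrite ger0_norm ?invr_ge0// invf_lt1 ?(base_gt0 b1)//.
    by rewrite ltr1n.
  - move=> n; rewrite /E; case: ifPn => y0 z zc; last exact: zc.
    have := mem_cell_index n y0; move: zc; rewrite /cell/= !in_itv/=.
    rewrite -natr1 mulrDr mulr1 /ball/= => /andP[z1 z2] /andP[y1 y2].
    by rewrite ltr_norml; apply/andP; split; lra.
  - move=> n; rewrite lebesgue_measure_ball ?(ltW (mesh_gt0 _ _))//.
    rewrite /E; case: ifPn => _.
      by rewrite lebesgue_measure_cell ?mesh_gt0// -EFinM lee_fin mulr_natl.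
    rewrite lebesgue_measure_ball ?(ltW (mesh_gt0 _ _))// -EFinM lee_fin.
    by rewrite ler_peMl ?ler1n ?mulrn_wge0 ?(ltW (mesh_gt0 _ _)).
have loc : locally_integrable setT f by apply: open_integrable_locally => //; exact: openT.
have := @nice_lebesgue_differentiation _ E hE f loc x fx.
(* The average over a cell of level [n] is the partial sum of [n + 1] levels. *)
move=> /fine_cvg; rewrite -[in X in _ -> X]cvg_shiftS.
apply: cvg_trans; apply: near_eq_cvg; near=> n.
rewrite /= haar_partialS// /E x0 cell_intE// lebesgue_measure_cell ?mesh_gt0//.
by rewrite inver gt_eqF ?mesh_gt0.
Unshelve. all: by end_near. Qed.

End haar_expansion.

Lemma besov_seminorm_cont_ge0 (R : realType) (alpha : R) (p q : \bar R) (f : R -> R) :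
  (0 <= besov_seminorm_cont alpha p q f)%E.
Proof. by case: q => [r| |]//; [exact: poweR_ge0 | exact: Lnorm_ge0]. Qed.

(** * Replacing a function by its restriction to the unit interval *)

Section restriction.
Context {R : realType}.
Local Notation mu := (@lebesgue_measure R).
Variable f : R -> R.
Local Notation g := (f \_ `[0, 1]).

Lemma haar_coef_restrict b j k i : haar_coef b g j k i = haar_coef b f j k i.
Proof.
by apply: eq_integral => x x01; rewrite patchE x01.
Qed.

Lemma LpD_restrict p : LpD `[0, 1] p g = LpD `[0, 1] p f.
Proof.
apply: eq_Lnorm => x; rewrite indicE patchE; case: ifPn => [xD//|xD].
by rewrite !mul0r.
Qed.

(** For [x] in [[0, 1 - h]], both [x] and [x + h] lie in [[0, 1]], where the two functions agree. *)
Lemma omega_restrict p t : omega p g t = omega p f t.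
Proof.
rewrite /omega; congr ereal_sup; apply: eq_imagel => h /=; rewrite in_itv/= => /andP[h0 _].
apply: eq_Lnorm => x; rewrite indicE; have [/set_mem/=|] := boolP (x \in _); last by rewrite !mul0r.
rewrite in_itv/= => /andP[x0 xh].
by rewrite !patchE !mem_set//= in_itv/=; apply/andP; split; lra.
Qed.

End restriction.

(** * Assembly of the norm estimate and of the embedding *)

Theorem theorem8 (R : realType) (b : nat) (alpha : R) (p q : \bar R) :
  (2 <= b)%N -> 0 < alpha < 1 ->
  (1 <= p)%E -> (1 <= q)%E ->
  forall f : R -> R, in_Besov alpha p q f ->
    (wav_norm b alpha p q f <=
       (Num.max 1 (2 `^ inv_exp p * (1 - b%:R^-1) * b%:R `^ alpha))%:E
       * besov_norm b alpha p q f)%E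
    /\ in_Hwav b alpha p q f.
Proof.
move=> b1 /andP[a0 _] p1 q1 f [fi fB].
(* The lemmas on cells assume integrability on the whole line, so they are applied to [g], which has
   the same coefficients, norm and modulus as [f]. *)
pose g := f \_ `[0, 1].
have gi : lebesgue_measure.-integrable [set: R] (EFin \o g).
  have := (@integrable_mkcond _ _ _ lebesgue_measure `[0, 1]%classic (EFin \o f) (measurable_itv _)).1 fi.
  by rewrite restrict_EFin.
set K := 2 `^ _ * _ * _; set C := Num.max _ _.
have K0 : 0 <= K by rewrite !mulr_ge0 ?powR_ge0// ltW// base_sub_gt0.
have omegaE : omega p g = omega p f by apply/funext => t; exact: omega_restrict.
have coefE : haar_coef b g = haar_coef b f.
  by apply/funext => j; apply/funext => k; apply/funext => i; exact: haar_coef_restrict.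
have LE : LpD `[0, 1] p g = LpD `[0, 1] p f by exact: LpD_restrict.
have L0 : (0 <= LpD `[0%R, 1%R] p f)%E by exact: Lnorm_ge0.
have wE : wav_norm b alpha p q f = lq_seq q (wav_level b alpha p g).
  by rewrite /wav_norm /wav_level coefE.
(* This bound serves twice: its last term is at most the discrete seminorm, and it is finite when
   the continuous seminorm is. *)
have wle : (wav_norm b alpha p q f <=
    LpD `[0%R, 1%R] p f + K%:E * lq_seq q (gap_omega b alpha p g))%E.
  rewrite wE -LE; apply: lq_seq_shift_le => //.
  - by move=> j; exact: wav_level_ge0.
  - by move=> j; exact: gap_omega_ge0.
  - exact: wav_level0_le.
  - by move=> j; exact: wav_levelS_le.
split.
  apply: (le_trans wle); rewrite /besov_norm.
  have S0 : (0 <= lq_seq q (gap_omega b alpha p g))%E.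
    by apply: lq_seq_ge0 => j; exact: gap_omega_ge0.
  have Sle : (lq_seq q (gap_omega b alpha p g) <= lq_seq q (fun j =>
      ((b%:R `^ alpha) ^+ j)%:E * omega p f ((b%:R ^+ j)^-1)))%E.
    apply: lq_seq_le => // j; first exact: gap_omega_ge0.
    rewrite /gap_omega omegaE lee_wpmul2l ?lee_fin ?exprn_ge0 ?powR_ge0//.
    by apply: omega_le; exact: ltW (gap_lt_mesh _ _).
  have C1 : 1 <= C by rewrite le_max lexx.
  have CK : K <= C by rewrite le_max lexx orbT.
  rewrite ge0_muleDr//; last exact: le_trans Sle.
  apply: leeD; first by rewrite -[leLHS]mul1e lee_wpmul2r// lee_fin.
  by apply: lee_pmul => //; rewrite lee_fin.
split=> //; split.
  apply: (le_lt_trans wle).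
  move: fB; rewrite /besov_norm_cont.
  have S0 : (0 <= besov_seminorm_cont alpha p q f)%E.
    exact: besov_seminorm_cont_ge0.
  move=> fB.
  have Ly : (LpD `[0%R, 1%R] p f < +oo)%E by apply: le_lt_trans fB; rewrite leeDl.
  have Sy : (besov_seminorm_cont alpha p q f < +oo)%E by apply: le_lt_trans fB; rewrite leeDr.
  have Gy : (lq_seq q (gap_omega b alpha p g) < +oo)%E.
    apply: lq_gap_omega_lty => //; first exact: ltW.
    by move: Sy; rewrite /besov_seminorm_cont omegaE.
  by rewrite lte_add_pinfty// lte_mul_pinfty// lee_fin.
move=> _.
have loc : locally_integrable setT g by apply: open_integrable_locally => //; exact: openT.
(* The point 1 lies in none of the half-open cells of [[0, 1[], so it is discarded as a null set. *)
have H1 : {ae lebesgue_measure, forall x : R, x != 1}.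
  exists [set 1]; split; [exact: measurable_set1|exact: lebesgue_measure_set1|].
  by move=> x /= /negP; rewrite negbK => /eqP.
apply: negligibleS (negligibleU H1 (lebesgue_differentiation loc)) => x.
apply: contra_notP => /not_orP[/contrapT x1 /contrapT gx] /=.
rewrite in_itv/= => /andP[x0 xle1].
have xlt1 : x < 1 by rewrite lt_neqAle x1.
have -> : haar_partial b f ^~ x = haar_partial b g ^~ x by rewrite /haar_partial coefE.
have -> : f x = g x by rewrite /g patchE mem_set//= in_itv/= x0 xle1.
exact: haar_partial_cvg.
Qed.
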